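(* Let $A$ and $B$ be densely defined closeable operators in a Hilbert space such that $D(AB)$ and $D(B^*A^* )$ are both dense. (a) If $(B^*A^* )^* = A^{**}B^{**}$, then the product $\overline{A}\,\overline{B}$ is closed and $(\overline{A}\,\overline{B})^* = \overline{B^*A^*}$. If moreover $A$ and $B$ are closed, then $AB$ is closed. If, further, the product $B^*A^*$ is closed, then $(AB)^* = B^*A^*$. (b) Similarly, if $(B^*A^* )^* = \overline{AB}$ and $B^*A^*$ is closed, then $(AB)^* = B^*A^*$. (c) Conversely, if $(AB)^* = B^*A^*$, then $B^*A^*$ is closed and $\overline{AB}\supset \overline{A}\,\overline{B}$.
   Context: Operators are linear, defined on linear subspaces (domains) $D(\cdot)$ of a Hilbert space, and not necessarily bounded. $T\supset S$ means $T$ extends $S$. The product $AB$ has domain $D(AB)=\{x\in D(B): Bx\in D(A)\}$. For a closeable operator $T$, $\overline{T}$ denotes its closure. $T^*$ is the adjoint of a densely defined $T$, $T^{**}=(T^* )^*$. (Under the density hypotheses above, $AB$ and $B^*A^*$ are closeable.) *)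

(* Defs.v *)
From HB Require Import structures.
From mathcomp Require Import all_boot all_order all_algebra.
From mathcomp Require Export sesquilinear complex.
From mathcomp Require Export boolp classical_sets reals topology normedtype.

Set Implicit Arguments.
Unset Strict Implicit.
Unset Printing Implicit Defensive.

Import Order.TTheory GRing.Theory Num.Theory.
Import numFieldNormedType.Exports.

Local Open Scope classical_set_scope.
Local Open Scope ring_scope.

(* [scalar_field theta] says that the type of scalars is either the field of
   real numbers with trivial conjugation or the field of complex numbers with
   complex conjugation. *)
Inductive scalar_field : forall K : numFieldType, (K -> K) -> Prop :=
| real_scalars (R : realType) : @scalar_field R idfun
| complex_scalars (R : realType) : @scalar_field R[i] (@Num.conj R[i]).

(* An inner product (linear in its first argument, theta-linear in the second)
   inducing the norm of a complete normed space makes it a Hilbert space. *)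
Definition hilbert_product (K : numFieldType) (theta : K -> K)
    (H : completeNormedModType K) (ip : {dot H for theta}) : Prop :=
  forall x : H, ip x x = `|x| ^+ 2.

(* A (possibly unbounded) operator T in H is represented by its graph, so that
   T (x, y) means "x \in D(T) and T x = y"; equality of operators is then
   equality of sets, [S `<=` T] means that T extends S, and [closure T] and
   [closed T] are the library's notions applied to the graph. *)
Section Operators.
Context (K : numFieldType) (H : completeNormedModType K).
Implicit Types S T : set (H * H).

Definition single_valued T : Prop :=
  forall x y z, T (x, y) -> T (x, z) -> y = z.

Definition linear_operator T : Prop :=
  [/\ T 0,
      forall (a : K) u v, T u -> T v -> T (a *: u + v)
    & single_valued T].

Definition dom T : set H := [set x | exists y, T (x, y)].

Definition densely_defined T : Prop := dense (dom T).

Definition closeable T : Prop := single_valued (closure T).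

Definition op_mul S T : set (H * H) :=
  [set u | exists y, T (u.1, y) /\ S (y, u.2)].

(* This set is single-valued exactly when T is densely defined. *)
Definition adjoint (theta : K -> K) (ip : {dot H for theta}) T :
    set (H * H) :=
  [set u | forall x y, T (x, y) -> ip y u.1 = ip x u.2].

End Operators.

Notation "S \op T" := (op_mul S T)
  (at level 40, left associativity, format "S  \op  T") : classical_set_scope.

(* Main.v *)
Require Import Defs.
From HB Require Import structures.
From mathcomp Require Import all_boot all_order all_algebra.
From mathcomp Require Import sesquilinear complex.
From mathcomp Require Import ring.
From mathcomp Require Import boolp classical_sets reals topology normedtype.

Import numFieldNormedType.Exports.
Local Open Scope classical_set_scope.
Local Open Scope ring_scope.

(** The whole theorem follows from five facts about adjoints of graphs:
    - an adjoint is always closed ([adjoint_closed]);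
    - taking adjoints reverses inclusions ([adjoint_anti]);
    - T and its closure have the same adjoint ([adjoint_closure]);
    - T** is the closure of T whenever T is a linear subspace of H * H
      ([adjointK]);
    - (ST)* extends T* S* ([adjoint_op_mul]).
    In (a) the hypothesis reads (B* A* )* = cl A cl B, so cl A cl B is an
    adjoint, hence closed, and its own adjoint is the double adjoint of B* A*,
    that is, the closure of B* A*.  In (b), (AB)* = (cl (AB))* = (B* A* )** is
    the closure of B* A*, which is B* A* itself.  In (c), B* A* is an adjoint,
    hence closed, and cl (AB) = (AB)** = (B* A* )* extends A** B** = cl A cl B.

    The deep one is [adjointK].  Give H * H the inner product
    <u, v> = <u.1, v.1> + <u.2, v.2> and put J (x, y) = (y, - x); then T* is
    the orthogonal complement of J T ([adjointE]), and since J is an isometry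
    with J^2 = - 1, T** is the double orthogonal complement of T.  What is
    left is the projection theorem.  It is proved in the form of
    [orthogonal_approximation]: the points of T that almost minimize the
    distance to u form a Cauchy filter, and if m is its limit then u - m is
    orthogonal to T. *)

Import Order.TTheory GRing.Theory Num.Theory.

Set Implicit Arguments.
Unset Strict Implicit.
Unset Printing Implicit Defensive.

(** * Real and complex scalars *)

Lemma scalar_field_rmorphism (K : numFieldType) (theta : K -> K) :
  scalar_field theta -> exists t : {rmorphism K -> K}, theta = t.
Proof. by case=> R; [exists idfun | exists Num.conj]. Qed.

Lemma scalar_field_mul_conj (K : numFieldType) (theta : K -> K) :
  scalar_field theta -> forall c, c * theta c = `|c| ^+ 2.
Proof.
case=> R c; last by rewrite normCK.
by rewrite real_normK ?num_real.
Qed.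

(** A general [numFieldType] has no infima; for complex scalars a set of
    nonnegative numbers consists of real numbers, and the infimum is that of
    their real parts. *)
Lemma scalar_field_inf (K : numFieldType) (theta : K -> K) (P : set K) :
  scalar_field theta -> P !=set0 -> (forall x, P x -> 0 <= x) ->
  exists d, (forall x, P x -> d <= x) /\
            forall e, 0 < e -> exists2 x, P x & x < d + e.
Proof.
have real_inf (R : realType) (Q : set R) : Q !=set0 ->
    (forall x, Q x -> 0 <= x) ->
    exists d, (forall x, Q x -> d <= x) /\
              forall e, 0 < e -> exists2 x, Q x & x < d + e.
  move=> Q0 Qge0.
  have Qinf : has_inf Q by split=> //; exists 0 => x /Qge0.
  exists (inf Q); split=> [x Qx|e e0]; first exact: ge_inf Qinf.2 _ Qx.
  exact: inf_adherent.
move=> sc; case: sc P => R P P0 Pge0; first exact: real_inf.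
have PRe x : P x -> x = (complex.Re x)%:C%C.
  by move=> /Pge0/ger0_real/RRe_real.
have [|x Qx|d [dle dinf]] := real_inf _ [set x | P x%:C%C].
- by have [x Px] := P0; exists (complex.Re x); rewrite /= -PRe.
- by rewrite -lecR Pge0.
exists d%:C%C; split=> [x Px|e e0].
  by rewrite (PRe x Px) lecR; apply: dle; rewrite /= -PRe.
have eE : e = (complex.Re e)%:C%C by rewrite RRe_real ?gtr0_real.
have [|x Px xlt] := dinf (complex.Re e); first by rewrite -ltcR -eE.
by exists x%:C%C => //; rewrite eE -rmorphD/= ltcR.
Qed.

(** * Completeness of a product *)

Section CompleteProduct.
Variables U V : completeType.

(* This lets structure inference join the pointed and the uniform structures of
   the product, as the limits below require. *)
HB.instance Definition _ := Pointed.on (U * V)%type.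

Lemma prod_cauchy_cvg (F : set_system (U * V)) :
  ProperFilter F -> cauchy F -> cvg F.
Proof.
move=> FF Fc.
have cauchy_proj (W : completeType) (p : U * V -> W) :
    unif_continuous p -> cvg (p @ F).
  move=> pc; apply/cauchy_cvgP => A /pc /Fc [[P Q] /= [FP FQ] PQA].
  exists (p @` P, p @` Q) => /=.
    by split; [apply: filterS FP|apply: filterS FQ] => x ?; exists x.
  by move=> [_ _] [/= [x Px <-] [y Qy <-]]; exact: (PQA (x, y)).
have cv1 : cvg (fst @ F).
  apply: cauchy_proj => A entA; exists (A, setT) => /=.
    by split=> //; exact: entourageT.
  by move=> [[x1 x2] [y1 y2]] [/= Ax _]; exists ((x1, y1), (x2, y2)).
have cv2 : cvg (snd @ F).
  apply: cauchy_proj => A entA; exists (setT, A) => /=.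
    by split=> //; exact: entourageT.
  by move=> [[x1 x2] [y1 y2]] [/= _ Ax]; exists ((x1, y1), (x2, y2)).
apply/cvg_ex; exists (lim (fst @ F), lim (snd @ F)).
apply: cvg_trans (cvg_pair cv1 cv2) => A.
by rewrite nbhs_simpl /=; apply: (@filterS _ F) => -[].
Qed.

HB.instance Definition _ :=
  Uniform_isComplete.Build (U * V)%type prod_cauchy_cvg.

End CompleteProduct.

HB.instance Definition _ (K : numFieldType) (U V : completeNormedModType K) :=
  NormedModule.on (U * V)%type.

(** * Sesquilinear algebra *)

Definition linear_subspace (K : numFieldType) (V : lmodType K) (S : set V) :=
  S 0 /\ forall (a : K) u v, S u -> S v -> S (a *: u + v).

Section DotProduct.
Variables (K : numFieldType) (theta : {rmorphism K -> K}).
Hypothesis scalarsP : scalar_field theta.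

Section Algebra.
Variables (V : lmodType K) (f : {dot V for theta}).

Lemma dotC x y : f x y = theta (f y x).
Proof. by rewrite [LHS](hermitian_subproof (s := f)) mul1r. Qed.

Lemma dot_ge0 x : 0 <= f x x.
Proof.
have [->|x0] := eqVneq x 0; first by rewrite linear0l.
exact/ltW/neq0_dnorm_gt0.
Qed.

Lemma dot_eq0 x : f x x = 0 -> x = 0.
Proof.
by move=> fx0; apply: contraPeq fx0 => /(neq0_dnorm_gt0 (s := f))/lt0r_neq0/eqP.
Qed.

(** Subtracting from x its component along y lowers the square norm by exactly
    |<x, y>|^2 / |y|^2.  This gives the Cauchy-Schwarz inequality, and bounds
    |<x, y>| when x is almost as short as it can be modulo the line of y. *)
Lemma dot_subproj x y : y != 0 ->
  f (x - (f x y / f y y) *: y) (x - (f x y / f y y) *: y) =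
  f x x - `|f x y| ^+ 2 / f y y.
Proof.
move=> /(neq0_dnorm_gt0 (s := f)) fy0; set a := _ / _.
have fxyE : f x y = a * f y y by rewrite divfK// lt0r_neq0.
clearbody a.
have aa : a * theta a * f y y = `|f x y| ^+ 2 / f y y.
  rewrite scalar_field_mul_conj// fxyE normrM exprMn (gtr0_norm fy0).
  by rewrite expr2 [in RHS]expr2 mulrA mulfK ?lt0r_neq0.
rewrite -aa linearBl 2!linearBr !(linearZl_LR f) !(linearZr_LR f) /=.
by rewrite (dotC y x) fxyE rmorphM/= -(dotC y y); ring.
Qed.

Lemma dot_cauchy_schwarz x y : `|f x y| ^+ 2 <= f x x * f y y.
Proof.
have [->|y0] := eqVneq y 0; first by rewrite !linear0r normr0 expr0n mulr0.
rewrite -ler_pdivrMr ?neq0_dnorm_gt0// -subr_ge0 -dot_subproj//.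
exact: dot_ge0.
Qed.

(** The parallelogram law, with w the midpoint of x and y. *)
Lemma dot_midpoint x y w : x + y = w + w ->
  f (x - y) (x - y) = (f x x + f y y) *+ 2 - f w w *+ 4.
Proof.
move=> xyE; have : f (x + y) (x + y) = f (w + w) (w + w) by rewrite xyE.
rewrite !(linearBl, linearBr, linearDl, linearDr)/= => fE.
have -> : f w w *+ 4 = f w w + f w w + (f w w + f w w) by ring.
by rewrite -fE; ring.
Qed.

End Algebra.

(** * Orthogonal projection *)

(** The norm is only assumed to be equivalent to the one given by the inner
    product because the norm of H * H is the maximum of the norms of the
    components. *)
Section Projection.
Variables (V : completeNormedModType K) (f : {dot V for theta}) (C : K).
Hypothesis norm_le_dot : forall x, `|x| ^+ 2 <= f x x.
Hypothesis dot_le_norm : forall x, f x x <= C * `|x| ^+ 2.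

Lemma dot_continuousl y : continuous (f ^~ y).
Proof.
move=> x; apply/cvgrPdist_lt => e e0.
have C0 : 0 <= C * f y y.
  have [->|y0] := eqVneq y 0; first by rewrite linear0l mulr0.
  rewrite mulr_ge0 ?dot_ge0// -(pmulr_lge0 C (x := `|y| ^+ 2)).
    exact: le_trans (dot_ge0 f y) (dot_le_norm y).
  by rewrite exprn_gt0 ?normr_gt0.
(* Adding 1 makes D positive even for y = 0. *)
pose D := C * f y y + 1.
have D1 : 1 <= D by rewrite /D lerDr.
have D0 : 0 < D by exact: lt_le_trans D1.
near=> t.
(* As D >= 1, the radius e / D makes |x - t|^2 D smaller than e^2. *)
have xt : `|x - t| < e / D by near: t; apply: cvgr_dist_lt; rewrite ?divr_gt0.
rewrite -linearBl/= -(@ltr_pXn2r _ 2) ?nnegrE ?(ltW e0)//.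
apply: le_lt_trans (dot_cauchy_schwarz f _ _) _.
apply: (@le_lt_trans _ _ (`|x - t| ^+ 2 * (C * f y y))).
  by rewrite mulrA [X in _ <= X * _]mulrC ler_wpM2r ?dot_ge0.
apply: (@le_lt_trans _ _ (`|x - t| ^+ 2 * D)).
  by rewrite ler_wpM2l ?exprn_ge0// /D lerDl.
rewrite -ltr_pdivlMr//; apply: (@lt_le_trans _ _ ((e / D) ^+ 2)).
  by rewrite ltr_pXn2r ?nnegrE// ltW// divr_gt0.
rewrite exprMn ler_wpM2l ?exprn_ge0 ?(ltW e0)// expr2.
rewrite ler_piMr ?invr_ge0 ?(ltW D0)//.
by rewrite invf_le1.
Unshelve. all: by end_near. Qed.

(** The projection theorem.  By the midpoint law, two points of S at square
    distance less than d + e from u, d being the infimum, are at square distance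
    less than 4 e from each other; so these points form a Cauchy filter.  By
    [dot_subproj], such a point x satisfies |<u - x, v>|^2 < e <v, v> for every
    nonzero v in S, and the limit m inherits <u - m, v> = 0. *)
Lemma orthogonal_approximation (S : set V) (u : V) : linear_subspace S ->
  exists2 m, closure S m & forall v, S v -> f (u - m) v = 0.
Proof.
move=> [S0 Slin].
pose q x := f (u - x) (u - x).
have [||d [dle dinf]] := @scalar_field_inf K theta (q @` S) scalarsP.
- by exists (q 0), 0.
- by move=> _ [x _ <-]; exact: dot_ge0.
pose near_min e := [set x | S x /\ q x < d + e].
pose F := filter_from [set e | 0 < e] near_min.
have FF : ProperFilter F.
  apply: filter_from_proper => [|e /dinf[_ [x Sx <-] qx]]; last by exists x.
  apply: filter_from_filter => [|e1 e2 /= e10 e20]; first by exists 1 => /=.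
  wlog e12 : e1 e2 e10 e20 / e1 <= e2.
    move=> wl; case/orP: (real_leVge (gtr0_real e10) (gtr0_real e20)) => le.
      exact: wl.
    by rewrite setIC; exact: wl.
  exists e1 => //= x [Sx qx]; split; split=> //.
  by rewrite (lt_le_trans qx)// lerD2l.
have Fnear e : 0 < e -> F (near_min e) by exists e.
have dist_min e x y : near_min e x -> near_min e y -> `|x - y| ^+ 2 < e *+ 4.
  move=> [Sx qx] [Sy qy]; apply: le_lt_trans (norm_le_dot _) _.
  pose z := 2^-1 *: (x + y).
  have zz : z + z = x + y.
    by rewrite /z -scalerDl -[2^-1]mul1r -splitr scale1r.
  have Sz : S z.
    rewrite /z -[_ *: _]addr0; apply: (Slin) => //.
    by rewrite -[x]scale1r; exact: Slin.
  have dq : d <= q z by apply: dle; exists z.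
  have -> : x - y = (u - y) - (u - x) by rewrite opprB [RHS]addrC addrA subrK.
  have xyz : u - y + (u - x) = u - z + (u - z).
    by rewrite (addrACA u (- y)) (addrACA u (- z)) -!opprD zz (addrC y).
  rewrite (dot_midpoint f xyz) -/(q x) -/(q y) -/(q z).
  rewrite ltrBlDr; apply: (@lt_le_trans _ _ ((d + e) *+ 4)).
    by rewrite (mulrnA _ 2 2) ltrMn2r//= mulr2n ltrD.
  by rewrite mulrnDl addrC lerD2l lerMn2r dq orbT.
have /cauchy_cvg Fcvg : cauchy F.
  apply/cauchy_ballP => e e0.
  have e40 : 0 < e ^+ 2 / 4 by rewrite divr_gt0 ?exprn_gt0.
  exists (near_min (e ^+ 2 / 4), near_min (e ^+ 2 / 4)).
    by split; exact: Fnear.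
  move=> [x y] [/= xm ym]; rewrite -ball_normE /ball_ /=.
  rewrite -(@ltr_pXn2r _ 2) ?nnegrE ?(ltW e0)//.
  apply: lt_le_trans (dist_min _ _ _ xm ym) _.
  by rewrite -[_ *+ 4]mulr_natr divfK ?pnatr_eq0.
pose m := lim F.
exists m => [B mB|v Sv].
  have FS : F S by apply: filterS (Fnear 1 ltr01) => x [].
  exact: filter_ex (filterI FS (Fcvg _ mB)).
have [->|v0] := eqVneq v 0; first by rewrite linear0r.
have fv0 := neq0_dnorm_gt0 (s := f) v v0.
have lim0 : f (u - x) v @[x --> F] --> (0 : K).
  apply/cvgr0Pnorm_lt => e e0.
  have e'0 : 0 < e ^+ 2 / f v v by rewrite divr_gt0 ?exprn_gt0.
  apply: filterS (Fnear _ e'0) => x [Sx qx].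
  rewrite -(@ltr_pXn2r _ 2) ?nnegrE ?(ltW e0)//.
  (* Minimality of d, tested at the point that corrects x along v. *)
  have /dle : (q @` S) (q (f (u - x) v / f v v *: v + x)).
    by exists (f (u - x) v / f v v *: v + x) => //; exact: Slin.
  rewrite /q (addrC _ x) opprD addrA dot_subproj// -/(q x) lerBrDr -lerBrDl.
  move=> cle.
  rewrite -(ltr_pM2r (x := (f v v)^-1)) ?invr_gt0//; apply: le_lt_trans cle _.
  by rewrite ltrBlDr addrC.
have limm : f (u - x) v @[x --> F] --> f (u - m) v.
  apply: (@cvg_comp _ _ _ (fun x => u - x) (f ^~ v) F (nbhs (u - m))).
    by apply: cvgB => //; exact: cvg_cst.
  exact: dot_continuousl.
exact: norm_cvg_unique limm lim0.
Qed.

End Projection.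

(** * Adjoints as orthogonal complements *)

Section GraphProduct.
Variables (H : completeNormedModType K) (ip : {dot H for theta}).

Definition graph_dot (u v : H * H) : K := ip u.1 v.1 + ip u.2 v.2.

Lemma graph_dot_bilinear : bilinear_for
  (GRing.Scale.Law.clone _ _ *%R _) (GRing.Scale.Law.clone _ _ (theta \; *%R) _)
  graph_dot.
Proof.
split=> [w|w] a u v; rewrite /graph_dot/=.
  by rewrite !linearDl/= !(linearZl_LR ip) mulrDr addrACA.
by rewrite !linearDr/= !(linearZr_LR ip)/= mulrDr addrACA.
Qed.

Lemma graph_dot_hermitian u v :
  graph_dot u v = (-1) ^+ false * theta (graph_dot v u).
Proof. by rewrite mul1r /graph_dot rmorphD/= -!dotC. Qed.

Lemma graph_dot_gt0 u : u != 0 -> 0 < graph_dot u u.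
Proof.
case: u => x y; rewrite /graph_dot/= => xy0.
have [x0|x0] := eqVneq x 0; last first.
  by rewrite ltr_pwDl ?dot_ge0// (neq0_dnorm_gt0 (s := ip)).
rewrite ltr_pwDr ?dot_ge0// (neq0_dnorm_gt0 (s := ip))//.
by apply: contraNneq xy0 => ->; rewrite x0.
Qed.

HB.instance Definition _ := bilinear_isBilinear.Build K
  (H * H)%type (H * H)%type K _ _ graph_dot graph_dot_bilinear.
HB.instance Definition _ := isHermitianSesquilinear.Build K (H * H)%type
  false theta graph_dot graph_dot_hermitian.
HB.instance Definition _ := isDotProduct.Build K (H * H)%type
  graph_dot graph_dot_gt0.

Hypothesis ipP : hilbert_product ip.

Lemma norm_le_graph_dot u : `|u| ^+ 2 <= graph_dot u u.
Proof.
rewrite /graph_dot !ipP.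
have -> : `|u| = Num.max `|u.1| `|u.2| by [].
case: (real_leP (normr_real u.1) (normr_real u.2)) => _.
  by rewrite lerDr exprn_ge0.
by rewrite lerDl exprn_ge0.
Qed.

Lemma graph_dot_le_norm u : graph_dot u u <= 2 * `|u| ^+ 2.
Proof.
rewrite /graph_dot !ipP mulr_natl mulr2n.
have -> : `|u| = Num.max `|u.1| `|u.2| by [].
by apply: lerD; rewrite ler_pXn2r ?nnegrE//;
  case: (real_leP (normr_real u.1) (normr_real u.2)) => // /ltW.
Qed.

(** T* is the orthogonal complement of J T, where J (x, y) = (y, - x). *)
Lemma adjointE (T : set (H * H)) u :
  adjoint ip T u <-> forall v, T v -> graph_dot u (v.2, - v.1) = 0.
Proof.
split=> [Tu [x y] /Tu uE|Tu x y /Tu]; rewrite /graph_dot/= linearNr.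
  by rewrite dotC uE -dotC subrr.
by move/eqP; rewrite subr_eq0 => /eqP uE; rewrite dotC uE -dotC.
Qed.

Lemma adjoint_closed (T : set (H * H)) : closed (adjoint ip T).
Proof.
have -> : adjoint ip T =
    \bigcap_(v in T) ((fun u => graph_dot u (v.2, - v.1)) @^-1` [set 0]).
  by apply/seteqP; split=> u; [move/adjointE | move=> Tu; apply/adjointE].
apply: closed_bigI => v _; apply: preimage_closed; last first.
  exact/accessible_closed_set1/hausdorff_accessible/norm_hausdorff.
by move=> u _; apply: (dot_continuousl graph_dot_le_norm).
Qed.

Lemma adjoint_anti (S T : set (H * H)) :
  S `<=` T -> adjoint ip T `<=` adjoint ip S.
Proof. by move=> ST u Tu x y /ST; exact: Tu. Qed.

Lemma adjoint_subspace (T : set (H * H)) : linear_subspace (adjoint ip T).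
Proof.
split=> [x y _|a u v Tu Tv x y Txy] /=; first by rewrite !linear0r.
by rewrite !linearDr/= !(linearZr_LR ip)/= (Tu x y)// (Tv x y).
Qed.

Lemma sub_adjointK (T : set (H * H)) : T `<=` adjoint ip (adjoint ip T).
Proof.
by move=> [x y] Txy p q /(_ x y Txy) pq; rewrite /= dotC -pq -dotC.
Qed.

Lemma closure_sub_adjointK (T : set (H * H)) :
  closure T `<=` adjoint ip (adjoint ip T).
Proof.
have /closure_id -> := @adjoint_closed (adjoint ip T).
exact/closure_subset/sub_adjointK.
Qed.

(** If u is in T**, let m be its best approximation in the closure of T, and
    r = u - m.  As r is orthogonal to T, J r belongs to T*, so that everything
    in T** is orthogonal to J (J r) = - r; this applies to u and to m, hence
    to r itself, and r = 0. *)
Lemma adjointK (T : set (H * H)) :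
  linear_subspace T -> adjoint ip (adjoint ip T) = closure T.
Proof.
move=> Tlin; apply/seteqP; split; last exact: closure_sub_adjointK.
move=> u TTu.
have [m Tm mE] := @orthogonal_approximation _ graph_dot 2
  norm_le_graph_dot graph_dot_le_norm T u Tlin.
set r := u - m in mE.
have Jr : adjoint ip T (r.2, - r.1).
  apply/adjointE => v Tv; rewrite -[RHS](mE v Tv) /graph_dot/=.
  by rewrite linearNl linearNr opprK addrC.
have ortho w : adjoint ip (adjoint ip T) w -> graph_dot w r = 0.
  move=> /adjointE/(_ _ Jr); rewrite /graph_dot/= !linearNr => /eqP.
  by rewrite -opprD oppr_eq0 => /eqP.
have r0 : r = 0.
  apply: (dot_eq0 (f := graph_dot)).
  rewrite {1}/r linearBl /= ortho// ortho ?subr0//.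
  exact: closure_sub_adjointK.
by have -> : u = m by apply/eqP; rewrite -subr_eq0 -/r r0.
Qed.

Lemma adjoint_closure (T : set (H * H)) : adjoint ip (closure T) = adjoint ip T.
Proof.
apply/seteqP; split; first exact/adjoint_anti/subset_closure.
apply: subset_trans (adjoint_anti (@closure_sub_adjointK T)).
exact: sub_adjointK.
Qed.

Lemma adjoint_op_mul (S T : set (H * H)) :
  adjoint ip T \op adjoint ip S `<=` adjoint ip (S \op T).
Proof.
move=> u [w [Sw Tw]] x z [y [/= Txy Syz]].
by rewrite (Sw y z Syz) -(Tw x y Txy).
Qed.

End GraphProduct.
End DotProduct.

(** * Products of closures *)

Lemma op_mul_subspace (K : numFieldType) (H : completeNormedModType K)
    (S T : set (H * H)) :
  linear_subspace S -> linear_subspace T -> linear_subspace (S \op T).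
Proof.
move=> [S0 Sl] [T0 Tl]; split; first by exists 0.
move=> a u v [y [Ty Sy]] [z [Tz Sz]]; exists (a *: y + z).
split; first exact: Tl a _ _ Ty Tz.
exact: Sl a _ _ Sy Sz.
Qed.

Lemma linear_operator_subspace (K : numFieldType) (H : completeNormedModType K)
    (T : set (H * H)) : linear_operator T -> linear_subspace T.
Proof. by case. Qed.

Unset Implicit Arguments.

Theorem theorem1 (K : numFieldType) (theta : K -> K)
    (H : completeNormedModType K) (ip : {dot H for theta})
    (A B : set (H * H)) :
  scalar_field theta -> hilbert_product ip ->
  linear_operator A -> linear_operator B ->
  densely_defined A -> densely_defined B ->
  closeable A -> closeable B ->
  densely_defined (A \op B) ->
  densely_defined (adjoint ip B \op adjoint ip A) ->
  [/\ adjoint ip (adjoint ip B \op adjoint ip A) =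
        adjoint ip (adjoint ip A) \op adjoint ip (adjoint ip B) ->
      [/\ closed (closure A \op closure B),
          adjoint ip (closure A \op closure B) =
            closure (adjoint ip B \op adjoint ip A)
        & closed A -> closed B ->
          closed (A \op B) /\
          (closed (adjoint ip B \op adjoint ip A) ->
           adjoint ip (A \op B) = adjoint ip B \op adjoint ip A)],
      adjoint ip (adjoint ip B \op adjoint ip A) = closure (A \op B) ->
      closed (adjoint ip B \op adjoint ip A) ->
      adjoint ip (A \op B) = adjoint ip B \op adjoint ip A
    & adjoint ip (A \op B) = adjoint ip B \op adjoint ip A ->
      closed (adjoint ip B \op adjoint ip A) /\
      closure A \op closure B `<=` closure (A \op B)].
Proof.
move=> sc ipP /linear_operator_subspace Alin /linear_operator_subspace Blin.
move=> _ _ _ _ _ _.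
(* Additivity of the conjugation is what makes the sum of two inner products
   hermitian on H * H. *)
have [t thetaE] := scalar_field_rmorphism sc; subst theta.
have AK := adjointK sc ipP Alin.
have BK := adjointK sc ipP Blin.
have ABK := adjointK sc ipP (op_mul_subspace Alin Blin).
have BAK := adjointK sc ipP
  (op_mul_subspace (adjoint_subspace ip B) (adjoint_subspace ip A)).
split=> [|BAE /closure_id BAc|ABE].
- rewrite AK BK => BAE.
  have adjE : adjoint ip (closure A \op closure B) =
              closure (adjoint ip B \op adjoint ip A) by rewrite -BAE BAK.
  have ABc : closed (closure A \op closure B).
    by rewrite -BAE; exact: adjoint_closed.
  split=> // /closure_id Ac /closure_id Bc.
  rewrite -Ac -Bc in adjE ABc.
  by split=> // /closure_id BAc; rewrite adjE -BAc.
- by rewrite [RHS]BAc -BAK BAE (adjoint_closure sc ipP).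
- split; first by rewrite -ABE; exact: adjoint_closed.
  rewrite -ABK ABE -AK -BK; exact: adjoint_op_mul.
Qed.
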